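(* In the setting and under the assumptions of the context, fix $x\in\mathcal X$ and write $\ell_k(z)=\ell_k(x,z)$, $\ell(z)=\ell(x,z)$. Let $$\mathbb Q_{2N}=\frac1N\sum_{i=1}^N\Big(\hat\alpha_{i\hat k_{i1}}\delta_{\hat z_i+\hat v_{i\hat k_{i1}}}+\hat\alpha_{i\hat k_{i2}}\delta_{\hat z_i+\hat v_{i\hat k_{i2}}}\Big)$$ be the $2N$-point distribution built from the active pairs, weights and perturbations returned by the algorithm MasterEval described in the context. There exists an algorithm that, given the output of MasterEval, constructs an approximate worst-case distribution $\mathbb Q_{N+1}\in\mathcal P$ (that is, an approximate maximizer of $\mathbb E_{z\sim\mathbb Q}[\ell(z)]$ over $\mathbb Q\in\mathcal P$) supported on at most $N+1$ atoms in time $O(N\log N)$ such that $$\mathbb E_{z\sim\mathbb Q_{N+1}}[\ell(z)]\ge\mathbb E_{z\sim\mathbb Q_{2N}}[\ell(z)].$$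
   Context: Notation: $[n]=\{1,\dots,n\}$; $\mathcal P(\mathcal Z)$ is the set of Borel probability measures on $\mathcal Z$; $\phi=\frac{\sqrt5-1}2$. Setting. $\mathcal X\subseteq\mathbb R^n$, $\mathcal Z\subseteq\mathbb R^m$. A transportation cost $c:\mathcal Z\times\mathcal Z\to\mathbb R_+$ is lower semicontinuous, satisfies $c(z,z)=0$ for all $z$, and $c(\cdot,\hat z)$ is convex for every fixed $\hat z\in\mathcal Z$. The optimal transport discrepancy is $\mathrm{OT}_c(\mathbb P,\mathbb Q)=\min_{\gamma}\mathbb E_{(z,\hat z)\sim\gamma}[c(z,\hat z)]$ over couplings $\gamma$ of $\mathbb P$ and $\mathbb Q$. Given $\hat z_1,\dots,\hat z_N\in\mathcal Z$, let $\hat{\mathbb P}=\frac1N\sum_{i=1}^N\delta_{\hat z_i}$; given $\rho>0$, let $\mathcal P=\{\mathbb P\in\mathcal P(\mathcal Z):\mathrm{OT}_c(\mathbb P,\hat{\mathbb P})\le\rho\}$. Regularity assumption. (i) $\mathcal X$ is nonempty and convex; there exist $\mathbb Q_0\in\mathcal P$ and $x_0\in\mathcal X$ such that $x\mapsto\mathbb E_{z\sim\mathbb Q_0}[\ell(x,z)]$ is inf-compact on $\mathcal X$ (all sublevel sets are compact) and $\mathbb E_{z\sim\mathbb Q_0}[\ell(x_0,z)]>-\infty$; $\mathcal Z$ is nonempty, closed and convex. (ii) $\ell(x,z)=\max_{k\in[K]}\ell_k(x,z)$ with $K\ge2$, where each $\ell_k:\mathbb R^n\times\mathbb R^m\to\mathbb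 R$ is real-valued, convex in its first and concave in its second argument. (iii) There exist a norm $\|\cdot\|$ on $\mathbb R^m$ and $p\ge1$ with $c(z,\hat z)\ge\|z-\hat z\|^p$ for all $z,\hat z\in\mathcal Z$; moreover, if $p=1$, then for every $x\in\mathcal X$ there exist $g>0$, $\hat z_0\in\mathcal Z$ and $r\in[0,1)$ such that $\ell(x,z)\le g[1+\|z-\hat z_0\|^r]$. Local worst-case oracle assumption. For any $k\in[K]$, $\hat z\in\mathcal Z$, radius $u\ge0$ and accuracy $\epsilon>0$ there is an algorithm, denoted $(\hat L,\hat v)\gets\mathsf{WCO}_k^\epsilon(\hat z,u)$, running in time $\mathsf{Cost}_{k,\epsilon}$ that returns $\hat v\in\mathbb R^m$ with $\hat z+\hat v\in\mathcal Z$, $c(\hat z+\hat v,\hat z)\le u$, together with $\hat L=\ell_k(\hat z+\hat v)$ satisfying $\hat L\ge\max\{\ell_k(\hat z+v):v\in\mathbb R^m,\hat z+v\in\mathcal Z,c(\hat z+v,\hat z)\le u\}-\epsilon$. Algorithms (all use the same tolerance $\eta>0$ and oracle precision $\epsilon>0$). InnerSolver$(i,k_1,k_2,b,\alpha_1)$ with $\alpha_1\in(0,1)$: set $\alpha_2=1-\alpha_1$, $L=0$, $U=b$, $\beta^{(1)}=U-\phi(U-L)$, $\beta^{(2)}=L+\phi(U-L)$. While $U-L>\eta$: for $j=1,2$ call $(L_1^{(j)},v_1^{(j)})\gets\mathsf{WCO}^\epsilon_{k_1}(\hat z_i,\beta^{(j)}/\alpha_1)$, $(L_2^{(j)},v_2^{(j)})\gets\mathsf{WCO}^\epsilon_{k_2}(\hat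 z_i,(b-\beta^{(j)})/\alpha_2)$ and set $V^{(j)}=\alpha_1L_1^{(j)}+\alpha_2L_2^{(j)}$; if $V^{(1)}<V^{(2)}$, set $L\gets\beta^{(1)}$, $\beta^{(1)}\gets\beta^{(2)}$, $\beta^{(2)}\gets L+\phi(U-L)$; otherwise set $U\gets\beta^{(2)}$, $\beta^{(2)}\gets\beta^{(1)}$, $\beta^{(1)}\gets U-\phi(U-L)$. Finally choose $j^\star\in\arg\max_jV^{(j)}$ and return the value $V^{(j^\star)}$ and the optimizer $(\alpha_1,\alpha_2,\beta^{(j^\star)},b-\beta^{(j^\star)},v_1^{(j^\star)},v_2^{(j^\star)})$, where $\beta^{(j^\star)}$ is the point at which $V^{(j^\star)}$ was evaluated. PairEval$(i,k_1,k_2,b)$: the same golden-section search over $\alpha\in[0,1]$ (start $L=0$, $U=1$, $\alpha^{(1)}=U-\phi(U-L)$, $\alpha^{(2)}=L+\phi(U-L)$, stop when $U-L\le\eta$, same interval updates), where the value $V^{(j)}$ and optimizer $s^{(j)}$ at $\alpha^{(j)}$ are those returned by InnerSolver$(i,k_1,k_2,b,\alpha^{(j)})$; return the larger of the two final values $V^{(j)}$ and its optimizer. LocalEval$(i,b)$: run PairEval$(i,k_1,k_2,b)$ for all $1\le k_1<k_2\le K$ and return the largest value, denoted $\hat V_i(b)$, its optimizer $\hat s$ and the pair $(\hat k_1,\hat k_2)$ attaining it. BudgetEval$(i,\lambda)$: golden-section search over $b\in[0,N\rho]$ (start $L=0$, $U=N\rho$, $b^{(1)}=U-\phi(U-L)$,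 $b^{(2)}=L+\phi(U-L)$, with values $\hat V^{(j)}$ from LocalEval$(i,b^{(j)})$). While $U-L>\eta$: if $\hat V^{(1)}-\lambda b^{(1)}<\hat V^{(2)}-\lambda b^{(2)}$, set $L\gets b^{(1)}$, $b^{(1)}\gets b^{(2)}$ (carrying its value along), $b^{(2)}\gets L+\phi(U-L)$ and evaluate $\hat V^{(2)}$; otherwise set $U\gets b^{(2)}$, $b^{(2)}\gets b^{(1)}$ (carrying its value along), $b^{(1)}\gets U-\phi(U-L)$ and evaluate $\hat V^{(1)}$. Return $\hat b_i(\lambda)=L$ and the output of LocalEval$(i,\hat b_i(\lambda))$. MasterEval: with $V_i(b)$ denoting the maximum of $\sum_{k=1}^K\alpha_k\ell_k(\hat z_i+v_k)$ over $\alpha_k\ge0$, $v_k\in\mathbb R^m$ with $\hat z_i+v_k\in\mathcal Z$, $\sum_k\alpha_k=1$, $\sum_k\alpha_kc(\hat z_i+v_k,\hat z_i)\le b$, it takes as input also an upper bound $U_\lambda\ge\lambda^\star$, where $\lambda^\star$ is an optimal multiplier of the constraint $\frac1N\sum_ib_i\le\rho$ in the problem of maximizing $\frac1N\sum_iV_i(b_i)$ over $b\in\mathbb R_+^N$ subject to that constraint. Start with $\lambda^{(1)}=0$, $\lambda^{(2)}=U_\lambda$, $\hat b_i^{(j)}$ the budget from BudgetEval$(i,\lambda^{(j)})$ for $j\in[2]$, $i\in[N]$. While $\lambda^{(2)}-\lambda^{(1)}>\eta$: set $\bar\lambda=(\lambda^{(1)}+\lambda^{(2)})/2$ and $\bar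 b_i$ the budget from BudgetEval$(i,\bar\lambda)$, $i\in[N]$; if $\sum_i\bar b_i>N\rho$ set $\lambda^{(1)}\gets\bar\lambda$, $\hat b_i^{(1)}\gets\bar b_i$ for all $i$; otherwise set $\lambda^{(2)}\gets\bar\lambda$, $\hat b_i^{(2)}\gets\bar b_i$ for all $i$. (Thus the lower multiplier is meant to have aggregate budget above, and the upper one below, the target.) Finally set $\theta=\frac{N\rho-\sum_i\hat b_i^{(2)}}{\sum_i\hat b_i^{(1)}-\sum_i\hat b_i^{(2)}}$, $\bar b_i=\theta\hat b_i^{(1)}+(1-\theta)\hat b_i^{(2)}$, run LocalEval$(i,\bar b_i)$ for each $i$ to obtain $(\hat V_i(\bar b_i),\hat s_i,\hat k_{i1},\hat k_{i2})$, and return the budgets $\{\bar b_i\}$ and these tuples. The weights and perturbations in $\hat s_i$ are denoted $\hat\alpha_{i\hat k_{i1}},\hat\alpha_{i\hat k_{i2}}$ and $\hat v_{i\hat k_{i1}},\hat v_{i\hat k_{i2}}$. *)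

(* Defs.v *)
From HB Require Import structures.
From mathcomp Require Import all_boot all_order all_algebra.
From mathcomp Require Import all_classical all_reals all_analysis.

Set Implicit Arguments.
Unset Strict Implicit.
Unset Printing Implicit Defensive.

Import Order.TTheory GRing.Theory Num.Theory.
Import numFieldNormedType.Exports.

Local Open Scope classical_set_scope.
Local Open Scope ring_scope.

(* R^m with its Borel sigma-algebra. *)
Notation borel R m := (g_sigma_algebraType (@open 'rV[R]_m)).

Section Distributions.
Variables (R : realType) (m : nat).
Local Notation V := 'rV[R]_m.

Definition expected_value (mu : set (borel R m) -> \bar R) (f : V -> R) : \bar R :=
  (\int[mu]_z (f z)%:E)%E.

(* [:: (w_1, z_1); ...] stands for the sum of the w_j times the Dirac mass
   at z_j. *)
Definition discrete (s : seq (R * V)) : set (borel R m) -> \bar R :=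
  fun A => (\sum_(a <- s) a.1%:E * dirac (a.2 : borel R m) A)%E.

Definition coupling (P Q : set (borel R m) -> \bar R)
    (g : probability (borel R m * borel R m)%type R) : Prop :=
  forall A : set (borel R m), measurable A ->
    g (fst @^-1` A) = P A /\ g (snd @^-1` A) = Q A.

(* c is only meaningful on Z x Z, which carries all the mass of the couplings
   of two distributions on Z. *)
Definition OT (Z : set V) (c : V -> V -> R)
    (P Q : set (borel R m) -> \bar R) : \bar R :=
  ereal_inf [set (\int[g]_(p in Z `*` Z) (c p.1 p.2)%:E)%E
            | g in [set g | coupling P Q g]].

Definition is_norm (nu : V -> R) : Prop :=
  [/\ forall v, 0 <= nu v,
      forall v, nu v = 0 -> v = 0,
      forall (a : R) v, nu (a *: v) = `|a| * nu v &
      forall v w, nu (v + w) <= nu v + nu w].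

End Distributions.

(* Data of the problem; K is the number of pieces of the loss, N the number of
   samples. *)
Record instance (R : realType) (n m K N : nat) := Instance {
  decisions : set 'rV[R]_n ;
  uncertainty : set 'rV[R]_m ;
  cost : 'rV[R]_m -> 'rV[R]_m -> R ;
  loss : 'rV[R]_n -> 'rV[R]_m -> R ;
  piece : 'I_K -> 'rV[R]_n -> 'rV[R]_m -> R ;
  sample : 'I_N -> 'rV[R]_m ;
  radius : R
}.

Section Assumptions.
Variables (R : realType) (n m K N : nat) (I : instance R n m K N).
Local Notation X := (decisions I).
Local Notation Z := (uncertainty I).
Local Notation c := (cost I).
Local Notation zhat := (sample I).
Local Notation rho := (radius I).

Definition empirical : set (borel R m) -> \bar R :=
  discrete [seq (N%:R^-1, zhat i) | i <- enum 'I_N].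

Definition ambiguity_set : set (probability (borel R m) R) :=
  [set P | P Z = 1%E /\ (OT Z c P empirical <= rho%:E)%E].

Definition transportation_cost : Prop :=
  [/\ forall z z', Z z -> Z z' -> 0 <= c z z',
      @lower_semicontinuous (subspace (Z `*` Z)) R (fun p => (c p.1 p.2)%:E),
      forall z, Z z -> c z z = 0 &
      forall z', Z z' -> convex_function Z (c ^~ z')].

Definition setting : Prop :=
  [/\ (0 < N)%N, transportation_cost, forall i, Z (zhat i) & 0 < rho].

Definition regularity_i : Prop :=
  [/\ X !=set0, convex_set X,
      exists Q0 x0,
        [/\ ambiguity_set Q0, X x0,
            forall t : R,
              compact [set x | X x /\ (expected_value Q0 (loss I x) <= t%:E)%E] &
            (-oo < expected_value Q0 (loss I x0))%E] &
      [/\ Z !=set0, closed Z & convex_set Z]].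

Definition regularity_ii : Prop :=
  [/\ (2 <= K)%N,
      forall x z, (exists k, loss I x z = piece I k x z) /\
                  (forall k, piece I k x z <= loss I x z),
      forall k z, convex_function setT (fun x => piece I k x z) &
      forall k x, convex_function setT (fun z => - piece I k x z)].

Definition regularity_iii : Prop :=
  exists (nu : 'rV[R]_m -> R) (p : R),
    [/\ is_norm nu, 1 <= p,
        forall z z', Z z -> Z z' -> nu (z - z') `^ p <= c z z' &
        p = 1 -> forall x, X x ->
          exists g z0 r, [/\ 0 < g, Z z0, 0 <= r < 1 &
            forall z, Z z -> loss I x z <= g * (1 + nu (z - z0) `^ r)]].

Definition regularity : Prop :=
  [/\ regularity_i, regularity_ii & regularity_iii].

(* wco eps k z u is the pair (value, perturbation) returned by the oracle for
   the k-th piece at the decision x.  Nothing is known of it for u < 0 or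
   eps <= 0. *)
Definition oracle_spec (x : 'rV[R]_n)
    (wco : R -> 'I_K -> 'rV[R]_m -> R -> R * 'rV[R]_m) : Prop :=
  forall eps k z u, 0 < eps -> Z z -> 0 <= u ->
    let: (val, v) := wco eps k z u in
    [/\ Z (z + v), c (z + v) z <= u, val = piece I k x (z + v) &
        forall w, Z (z + w) -> c (z + w) z <= u ->
          piece I k x (z + w) - eps <= val].

Definition local_value (x : 'rV[R]_n) (i : 'I_N) (b : R) : \bar R :=
  ereal_sup [set y | exists (al : 'I_K -> R) (v : 'I_K -> 'rV[R]_m),
    [/\ forall k, 0 <= al k /\ Z (zhat i + v k),
        \sum_k al k = 1,
        \sum_k al k * c (zhat i + v k) (zhat i) <= b &
        y = (\sum_k al k * piece I k x (zhat i + v k))%:E]].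

Definition budget_value (x : 'rV[R]_n) : \bar R :=
  ereal_sup [set y | exists b : 'I_N -> R,
    [/\ forall i, 0 <= b i,
        N%:R^-1 * \sum_i b i <= rho &
        y = (N%:R^-1%:E * \sum_i local_value x i (b i))%E]].

Definition budget_dual (x : 'rV[R]_n) (lam : R) : \bar R :=
  ereal_sup [set y | exists b : 'I_N -> R,
    (forall i, 0 <= b i) /\
    y = (N%:R^-1%:E * (\sum_i local_value x i (b i))
         + (lam * (rho - N%:R^-1 * \sum_i b i))%:E)%E].

Definition optimal_multiplier (x : 'rV[R]_n) (lam : R) : Prop :=
  0 <= lam /\ budget_dual x lam = budget_value x.

End Assumptions.

Section GoldenSection.
Variables (R : realType) (S : Type) (eta : R).
Implicit Types (L U t : R) (o f : R * S).

Definition phi : R := (Num.sqrt 5 - 1) / 2.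

(* ev t o: an evaluation at the point t may return o = (value, optimizer).
   gs_loop ev L U t1 t2 o1 o2 f1 f2: the loop entered with interval [L, U],
   points t1, t2 and o1, o2 as latest evaluations ends with f1, f2 as latest
   evaluations.  The points are moved after they are evaluated, so f1, f2 need
   not belong to the final points. *)
Inductive gs_loop (ev : R -> R * S -> Prop) :
    R -> R -> R -> R -> R * S -> R * S -> R * S -> R * S -> Prop :=
| gs_stop L U t1 t2 o1 o2 :
    U - L <= eta -> gs_loop ev L U t1 t2 o1 o2 o1 o2
| gs_right L U t1 t2 o1 o2 o1' o2' f1 f2 :
    eta < U - L -> ev t1 o1' -> ev t2 o2' -> o1'.1 < o2'.1 ->
    gs_loop ev t1 U t2 (t1 + phi * (U - t1)) o1' o2' f1 f2 ->
    gs_loop ev L U t1 t2 o1 o2 f1 f2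
| gs_left L U t1 t2 o1 o2 o1' o2' f1 f2 :
    eta < U - L -> ev t1 o1' -> ev t2 o2' -> o2'.1 <= o1'.1 ->
    gs_loop ev L t2 (t2 - phi * (t2 - L)) t1 o1' o2' f1 f2 ->
    gs_loop ev L U t1 t2 o1 o2 f1 f2.

(* The initial evaluations o1, o2 only matter when the loop body is never
   executed.  Ties between the two final values may be broken either way. *)
Definition golden_section (ev : R -> R * S -> Prop) (a b : R) o : Prop :=
  let t1 := b - phi * (b - a) in
  let t2 := a + phi * (b - a) in
  exists o1 o2 f1 f2,
    [/\ ev t1 o1, ev t2 o2, gs_loop ev a b t1 t2 o1 o2 f1 f2 &
        (o = f1 /\ f2.1 <= f1.1) \/ (o = f2 /\ f1.1 <= f2.1)].

End GoldenSection.

Record optimizer (R : realType) (m : nat) := Optimizer {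
  weight1 : R ; weight2 : R ;
  share1 : R ; share2 : R ;
  pert1 : 'rV[R]_m ; pert2 : 'rV[R]_m
}.

Record local_output (R : realType) (m K : nat) := LocalOutput {
  lo_value : R ;
  lo_opt : optimizer R m ;
  lo_k1 : 'I_K ;
  lo_k2 : 'I_K
}.

(* The algorithms are given as relations between inputs and possible outputs.
   The relations are partial where the algorithms are: there is no output when
   the oracle would be called with a negative radius. *)
Section Algorithms.
Variables (R : realType) (n m K N : nat) (I : instance R n m K N).
Variables (wco : R -> 'I_K -> 'rV[R]_m -> R -> R * 'rV[R]_m) (eps eta : R).
Local Notation zhat := (sample I).
Local Notation target := (N%:R * radius I).

Definition inner_eval (i : 'I_N) (k1 k2 : 'I_K) (b a1 be : R)
    (o : R * optimizer R m) : Prop :=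
  let a2 := 1 - a1 in
  let: (L1, v1) := wco eps k1 (zhat i) (be / a1) in
  let: (L2, v2) := wco eps k2 (zhat i) ((b - be) / a2) in
  [/\ 0 <= be / a1, 0 <= (b - be) / a2 &
      o = (a1 * L1 + a2 * L2, Optimizer a1 a2 be (b - be) v1 v2)].

Definition inner_solver i k1 k2 (b a1 : R) (o : R * optimizer R m) : Prop :=
  golden_section eta (inner_eval i k1 k2 b a1) 0 b o.

Definition pair_eval i k1 k2 (b : R) (o : R * optimizer R m) : Prop :=
  golden_section eta (inner_solver i k1 k2 b) 0 1 o.

Definition local_eval (i : 'I_N) (b : R) (o : local_output R m K) : Prop :=
  [/\ (lo_k1 o < lo_k2 o)%N,
      pair_eval i (lo_k1 o) (lo_k2 o) b (lo_value o, lo_opt o) &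
      forall k1 k2 : 'I_K, (k1 < k2)%N ->
        exists2 o', pair_eval i k1 k2 b o' & o'.1 <= lo_value o].

Definition local_eval_value (i : 'I_N) (b val : R) : Prop :=
  exists2 o, local_eval i b o & lo_value o = val.

(* budget_loop i lam L U b1 b2 V1 V2 r: r is the lower end of the final
   interval. *)
Inductive budget_loop (i : 'I_N) (lam : R) :
    R -> R -> R -> R -> R -> R -> R -> Prop :=
| budget_stop L U b1 b2 V1 V2 :
    U - L <= eta -> budget_loop i lam L U b1 b2 V1 V2 L
| budget_right L U b1 b2 V1 V2 V' r :
    eta < U - L -> V1 - lam * b1 < V2 - lam * b2 ->
    local_eval_value i (b1 + phi R * (U - b1)) V' ->
    budget_loop i lam b1 U b2 (b1 + phi R * (U - b1)) V2 V' r ->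
    budget_loop i lam L U b1 b2 V1 V2 r
| budget_left L U b1 b2 V1 V2 V' r :
    eta < U - L -> V2 - lam * b2 <= V1 - lam * b1 ->
    local_eval_value i (b2 - phi R * (b2 - L)) V' ->
    budget_loop i lam L b2 (b2 - phi R * (b2 - L)) b1 V' V1 r ->
    budget_loop i lam L U b1 b2 V1 V2 r.

Definition budget_eval (i : 'I_N) (lam bhat : R) : Prop :=
  let b1 := target - phi R * target in
  let b2 := phi R * target in
  exists V1 V2,
    [/\ local_eval_value i b1 V1, local_eval_value i b2 V2 &
        budget_loop i lam 0 target b1 b2 V1 V2 bhat].

(* The last two arguments are the final lower- and upper-multiplier budgets. *)
Inductive master_loop : R -> R -> ('I_N -> R) -> ('I_N -> R) ->
    ('I_N -> R) -> ('I_N -> R) -> Prop :=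
| master_stop l1 l2 b1 b2 :
    l2 - l1 <= eta -> master_loop l1 l2 b1 b2 b1 b2
| master_lower l1 l2 b1 b2 b f1 f2 :
    eta < l2 - l1 -> (forall i, budget_eval i ((l1 + l2) / 2) (b i)) ->
    target < \sum_i b i -> master_loop ((l1 + l2) / 2) l2 b b2 f1 f2 ->
    master_loop l1 l2 b1 b2 f1 f2
| master_upper l1 l2 b1 b2 b f1 f2 :
    eta < l2 - l1 -> (forall i, budget_eval i ((l1 + l2) / 2) (b i)) ->
    \sum_i b i <= target -> master_loop l1 ((l1 + l2) / 2) b1 b f1 f2 ->
    master_loop l1 l2 b1 b2 f1 f2.

(* theta is a quotient by s1 - s2.  When s1 = s2 it has no meaning; since
   x / 0 = 0 the clause s2 <= target then admits, in addition, the run that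
   continues with the upper-multiplier budgets if these are affordable. *)
Definition master_eval (Ulam : R) (bbar : 'I_N -> R)
    (out : 'I_N -> local_output R m K) : Prop :=
  exists i1 i2 b1 b2 : 'I_N -> R,
    let s1 := \sum_i b1 i in
    let s2 := \sum_i b2 i in
    let theta := (target - s2) / (s1 - s2) in
    [/\ forall i, budget_eval i 0 (i1 i) /\ budget_eval i Ulam (i2 i),
        master_loop 0 Ulam i1 i2 b1 b2,
        s1 != s2 \/ s2 <= target,
        forall i, bbar i = theta * b1 i + (1 - theta) * b2 i &
        forall i, local_eval i (bbar i) (out i)].

Definition atoms2N (out : 'I_N -> local_output R m K) : seq (R * 'rV[R]_m) :=
  flatten [seq (let s := lo_opt (out i) in
                [:: (N%:R^-1 * weight1 s, zhat i + pert1 s);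
                    (N%:R^-1 * weight2 s, zhat i + pert2 s)])
          | i <- enum 'I_N].

End Algorithms.

(* Cost model: a first-order functional language with exact real arithmetic,
   in which every evaluation step costs 1.  A program is a finite list of
   one-argument, mutually recursive function bodies that does not depend on
   the size of the input; lists are linked cells built from pairs and a unit
   value.  Vectors of R^m, real numbers and piece indices are atomic values;
   programs access them only through the listed primitives, which include the
   evaluation of the loss and of the transportation cost. *)
Inductive arith_op := OAdd | OSub | OMul | ODiv.

(* Variables are de Bruijn indices.  ECase e e1 e2 continues with e1 on the
   unit value, and with e2 on a pair, whose first and second components become
   variables 0 and 1. *)
Inductive expr :=
| EVar of nat
| EUnit
| EPair of expr & expr
| ECase of expr & expr & expr
| ELet of expr & expr
| ECall of nat & expr
| EZero
| EOne
| EArith of arith_op & expr & expr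
| EIfLe of expr & expr & expr & expr
| EVecAdd of expr & expr
| ELoss of expr
| ECost of expr & expr.

Definition program := seq expr.

Inductive value (R : realType) (m : nat) :=
| VUnit
| VPair of value R m & value R m
| VReal of R
| VVec of 'rV[R]_m
| VIdx of nat.
Arguments VUnit {R m}.
Arguments VReal {R m} _.
Arguments VVec {R m} _.
Arguments VIdx {R m} _.

Definition arith (R : realType) (op : arith_op) (r s : R) : R :=
  match op with
  | OAdd => r + s
  | OSub => r - s
  | OMul => r * s
  | ODiv => r / s
  end.

Section Semantics.
Variables (R : realType) (m : nat).
Variables (lossf : 'rV[R]_m -> R) (costf : 'rV[R]_m -> 'rV[R]_m -> R).
Variable prog : program.
Local Notation val := (value R m).

(* eval env e v t: in the environment env, e evaluates to v in t steps. *)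
Inductive eval : seq val -> expr -> val -> nat -> Prop :=
| eval_var env i : (i < size env)%N ->
    eval env (EVar i) (nth VUnit env i) 1
| eval_unit env : eval env EUnit VUnit 1
| eval_pair env e1 e2 v1 v2 t1 t2 :
    eval env e1 v1 t1 -> eval env e2 v2 t2 ->
    eval env (EPair e1 e2) (VPair v1 v2) (t1 + t2).+1
| eval_case_unit env e e1 e2 v t t' :
    eval env e VUnit t -> eval env e1 v t' ->
    eval env (ECase e e1 e2) v (t + t').+1
| eval_case_pair env e e1 e2 v1 v2 v t t' :
    eval env e (VPair v1 v2) t -> eval [:: v1, v2 & env] e2 v t' ->
    eval env (ECase e e1 e2) v (t + t').+1
| eval_let env e1 e2 v1 v2 t1 t2 :
    eval env e1 v1 t1 -> eval (v1 :: env) e2 v2 t2 ->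
    eval env (ELet e1 e2) v2 (t1 + t2).+1
| eval_call env f e v w t t' :
    eval env e v t -> (f < size prog)%N ->
    eval [:: v] (nth EUnit prog f) w t' ->
    eval env (ECall f e) w (t + t').+1
| eval_zero env : eval env EZero (VReal 0) 1
| eval_one env : eval env EOne (VReal 1) 1
| eval_arith env op e1 e2 r1 r2 t1 t2 :
    eval env e1 (VReal r1) t1 -> eval env e2 (VReal r2) t2 ->
    eval env (EArith op e1 e2) (VReal (arith op r1 r2)) (t1 + t2).+1
| eval_if_le env e1 e2 e3 e4 r1 r2 v t1 t2 t :
    eval env e1 (VReal r1) t1 -> eval env e2 (VReal r2) t2 ->
    eval env (if r1 <= r2 then e3 else e4) v t ->
    eval env (EIfLe e1 e2 e3 e4) v (t1 + t2 + t).+1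
| eval_vec_add env e1 e2 z1 z2 t1 t2 :
    eval env e1 (VVec z1) t1 -> eval env e2 (VVec z2) t2 ->
    eval env (EVecAdd e1 e2) (VVec (z1 + z2)) (t1 + t2).+1
| eval_loss env e z t :
    eval env e (VVec z) t -> eval env (ELoss e) (VReal (lossf z)) t.+1
| eval_cost env e1 e2 z1 z2 t1 t2 :
    eval env e1 (VVec z1) t1 -> eval env e2 (VVec z2) t2 ->
    eval env (ECost e1 e2) (VReal (costf z1 z2)) (t1 + t2).+1.

(* The entry point is function 0. *)
Definition runs (input output : val) (t : nat) : Prop :=
  eval [:: input] (ECall 0 (EVar 0)) output t.

End Semantics.

Section Encoding.
Variables (R : realType) (n m K N : nat) (I : instance R n m K N).
Local Notation val := (value R m).

Definition enc_seq (s : seq val) : val := foldr (@VPair R m) VUnit s.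

Definition enc_optimizer (s : optimizer R m) : val :=
  enc_seq [:: VReal (weight1 s); VReal (weight2 s);
              VReal (share1 s); VReal (share2 s);
              VVec (pert1 s); VVec (pert2 s)].

Definition enc_master (bbar : 'I_N -> R)
    (out : 'I_N -> local_output R m K) : val :=
  VPair (VReal (radius I))
    (enc_seq [seq enc_seq [:: VVec (sample I i); VReal (bbar i);
                              VReal (lo_value (out i));
                              enc_optimizer (lo_opt (out i));
                              VIdx (lo_k1 (out i)); VIdx (lo_k2 (out i))]
             | i <- enum 'I_N]).

Definition enc_atoms (s : seq (R * 'rV[R]_m)) : val :=
  enc_seq [seq VPair (VReal a.1) (VVec a.2) | a <- s].

End Encoding.

(* Main.v *)
Require Import Defs.
From HB Require Import structures.
From mathcomp Require Import all_boot all_order all_algebra.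
From mathcomp Require Import all_classical all_reals all_analysis.
From mathcomp Require Import measurable_realfun ring lra zify.

(* Each sample i carries two points y, y' of weights 1 - a and a, so the
   2N-point distribution is a point of the polytope of weights a_i in [0, 1]
   with one linear cost constraint, on which the expected loss is linear: an
   extreme point that is at least as good has at most one fractional weight,
   hence N + 1 atoms.  Such a point is reached without sorting.  Go through the
   samples and keep one sample with a fractional weight.  When the next one
   comes, move mass in the two samples in opposite directions, at constant
   total cost and in the direction in which the loss does not decrease, until
   one of the two weights is 0 or 1.  That sample contributes a single atom and
   the other one is kept.  This takes O(1) steps per sample, so linear time.
   Feasibility of the initial weights comes from the oracle: the evaluated
   weights are interior and the radii passed to the oracle are the budget
   shares divided by them. *)

Set Implicit Arguments.
Unset Strict Implicit.
Unset Printing Implicit Defensive.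

Import Order.TTheory GRing.Theory Num.Theory.
Import numFieldNormedType.Exports.

Local Open Scope classical_set_scope.
Local Open Scope ring_scope.

(** * Exchanging mass between two samples *)

(* Item z a y y' stands for the distribution (1 - a) delta_y + a delta_y' into
   which the unit mass at the sample z is transported. *)
Record item (R : realType) (m : nat) := Item {
  centre : 'rV[R]_m ;
  tilt : R ;
  low : 'rV[R]_m ;
  high : 'rV[R]_m
}.

Definition nonneg_weights (R : realType) (T : Type) (s : seq (R * T)) :=
  all (fun a => 0 <= a.1) s.

Section Exchange.
Variables (R : realType) (m : nat).
Variables (lossf : 'rV[R]_m -> R) (costf : 'rV[R]_m -> 'rV[R]_m -> R).
Implicit Types (A B : item R m) (w t : R) (s : seq (item R m)).
Local Notation V := 'rV[R]_m.

(** [f] receives the transported point and its sample, so that one formula serves the cost and,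
    ignoring the second argument, the loss. *)
Definition average (f : V -> V -> R) A : R :=
  (1 - tilt A) * f (low A) (centre A) + tilt A * f (high A) (centre A).

Definition retilt A t := Item (centre A) t (low A) (high A).

Definition flip A := Item (centre A) (1 - tilt A) (high A) (low A).

Definition dcost A := costf (high A) (centre A) - costf (low A) (centre A).
Definition dloss A := lossf (high A) - lossf (low A).

(* Ties in the cost are broken by the loss, so that raising the weight of the
   high point is never harmful when it is free. *)
Definition ordered A := (0 <= dcost A) && ((dcost A <= 0) ==> (0 <= dloss A)).

Definition orient A := if ordered A then A else flip A.

(* Raises A and lowers B at constant total cost until A is all high or B all
   low; the point that then carries a full unit of mass is split off. *)
Definition transfer A B : (V * V) * item R m :=
  if (1 - tilt A) * dcost A <= tilt B * dcost B
  then ((high A, centre A),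
        retilt B (tilt B - (1 - tilt A) * dcost A / dcost B))
  else ((low B, centre B),
        retilt A (tilt A + tilt B * dcost B / dcost A)).

(* Compares the gains per unit of cost; multiplied out since dcost may be 0. *)
Definition settle A B : (V * V) * item R m :=
  if dloss B * dcost A <= dloss A * dcost B then transfer A B else transfer B A.

(** Each entry keeps the sample next to the point, so that the list is a transport plan and not only
    a distribution. *)
Fixpoint collapse w A s : seq (R * (V * V)) :=
  if s is B :: s' then (w, (settle A B).1) :: collapse w (settle A B).2 s'
  else [:: (w * (1 - tilt A), (low A, centre A));
           (w * tilt A, (high A, centre A))].

Definition valid (Z : set V) A :=
  [/\ 0 <= tilt A <= 1, ordered A, Z (low A), Z (high A) & Z (centre A)].

Lemma averageE f A : average f A =
  f (low A) (centre A) +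
  tilt A * (f (high A) (centre A) - f (low A) (centre A)).
Proof. by rewrite /average; ring. Qed.

Lemma average_flip f A : average f (flip A) = average f A.
Proof. by rewrite /average /=; ring. Qed.

Lemma average_orient f A : average f (orient A) = average f A.
Proof. by rewrite /orient; case: ifP => // _; rewrite average_flip. Qed.

Lemma centre_orient A : centre (orient A) = centre A.
Proof. by rewrite /orient; case: ifP. Qed.

(** If [dcost A < 0], flipping makes it positive; otherwise [dcost A = 0] and [dloss A < 0], and
    flipping makes the loss difference positive. *)
Lemma ordered_orient A : ordered (orient A).
Proof.
rewrite /orient; case: ifPn => //; rewrite /ordered /dcost /dloss /=.
move: (costf _ _) (costf _ _) (lossf _) (lossf _) => c1 c2 l1 l2.
rewrite !subr_ge0 !subr_le0 negb_and negb_imply -!ltNge.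
case/orP => [c12|/andP[-> /ltW ->]]; last by rewrite implybT.
by rewrite ltW// leNgt c12.
Qed.

Lemma valid_orient Z A : 0 <= tilt A <= 1 -> Z (low A) -> Z (high A) ->
  Z (centre A) -> valid Z (orient A).
Proof.
move=> t01 lA hA cA; split; [|exact: ordered_orient|..];
  rewrite /orient; case: ifP => //= _.
by case/andP: t01 => t0 t1; rewrite subr_ge0 t1 gerBl.
Qed.

(** Raising [A] by [s] and lowering [B] by [t] keeps the cost when [s * dcost A = t * dcost B]; the
    gain [s * dloss A - t * dloss B] is then nonnegative by the comparison of rates. The last clause
    preserves the marginal on the samples. *)
Lemma transfer_spec Z A B : valid Z A -> valid Z B ->
  dloss B * dcost A <= dloss A * dcost B ->
  let: (p, C) := transfer A B in
  [/\ valid Z C, Z p.1 /\ Z p.2,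
      costf p.1 p.2 + average costf C = average costf A + average costf B,
      average (fun y _ => lossf y) A + average (fun y _ => lossf y) B <=
        lossf p.1 + average (fun y _ => lossf y) C &
      forall F : V -> R, F p.2 + F (centre C) = F (centre A) + F (centre B)].
Proof.
move=> [/andP[a0 a1] oA lA hA cA] [/andP[b0 b1] oB lB hB cB] g.
move: (oA) (oB); rewrite /ordered => /andP[x0 xu] /andP[y0 yv].
rewrite /transfer; case: ifPn => [le1|].
  have [d0 dy dv] : [/\ 0 <= (1 - tilt A) * dcost A / dcost B <= tilt B,
      (1 - tilt A) * dcost A / dcost B * dcost B = (1 - tilt A) * dcost A &
      (1 - tilt A) * dcost A / dcost B * dloss B <= (1 - tilt A) * dloss A].
    (* If [dcost B = 0], the quotient is 0 by convention: either [A] is all high already, or raising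
       it is free and the tie-breaking in [ordered] gives [0 <= dloss A]. *)
    have [y00|y_neq0] := eqVneq (dcost B) 0.
      have x00 : (1 - tilt A) * dcost A = 0.
        apply/le_anti; rewrite (le_trans le1) ?y00 ?mulr0//=.
        by rewrite mulr_ge0// subr_ge0.
      rewrite x00 !mul0r b0 lexx; split=> //.
      move/eqP: x00; rewrite mulf_eq0 => /orP[/eqP->|/eqP x00].
        by rewrite mul0r.
      by apply: mulr_ge0; [rewrite subr_ge0|apply: (implyP xu); rewrite x00].
    have y_gt0 : 0 < dcost B by rewrite lt_def y_neq0.
    rewrite ler_pdivrMr// le1 andbT divfK//; split=> //.
      by rewrite divr_ge0// mulr_ge0// subr_ge0.
    rewrite mulrAC ler_pdivrMr// -!mulrA ler_wpM2l ?subr_ge0//.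
    by rewrite mulrC.
  move: d0 dy dv; set e := _ / _ => /andP[e0 eb] ey ev; split=> //=.
  - by split; rewrite //= subr_ge0 eb lerBlDr (le_trans b1)// lerDl.
  - rewrite !averageE /= -/(dcost A) -/(dcost B).
    by rewrite mulrBl ey /dcost; ring.
  - rewrite !averageE /= -/(dloss A) -/(dloss B).
    rewrite mulrBl -subr_ge0.
    rewrite [X in 0 <= X](_ : _ = (1 - tilt A) * dloss A - e * dloss B).
      by rewrite subr_ge0.
    by rewrite /dloss; ring.
rewrite -ltNge => lt1.
(* The cost released by emptying [B] is nonnegative and smaller than what [A] can absorb, so the
   division by [dcost A] is genuine. *)
have x_gt0 : 0 < dcost A.
  rewrite lt_def x0 andbT; apply: contraTneq lt1 => ->.
  by rewrite mulr0 -leNgt mulr_ge0.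
have e0 : 0 <= tilt B * dcost B / dcost A by rewrite divr_ge0// mulr_ge0.
have e1 : tilt B * dcost B / dcost A <= 1 - tilt A.
  by rewrite ler_pdivrMr// ltW.
have ex : tilt B * dcost B / dcost A * dcost A = tilt B * dcost B.
  by rewrite divfK// gt_eqF.
have ev : tilt B * dloss B <= tilt B * dcost B / dcost A * dloss A.
  rewrite mulrAC ler_pdivlMr// -!mulrA ler_wpM2l//.
  by rewrite (mulrC (dcost B)).
move: e0 e1 ex ev; set e := _ / _ => e0 e1 ex ev; split=> //=.
- by split; rewrite //= addr_ge0//= -lerBrDl.
- rewrite !averageE /= -/(dcost A) -/(dcost B) mulrDl ex.
  by rewrite /dcost; ring.
- rewrite !averageE /= -/(dloss A) -/(dloss B) mulrDl -subr_ge0.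
  rewrite [X in 0 <= X](_ : _ = e * dloss A - tilt B * dloss B).
    by rewrite subr_ge0.
  by ring.
- by move=> F; rewrite addrC.
Qed.

(** The comparison of rates holds in one of the two orders, and the conclusion is symmetric in [A]
    and [B]. *)
Lemma settle_spec Z A B : valid Z A -> valid Z B ->
  let: (p, C) := settle A B in
  [/\ valid Z C, Z p.1 /\ Z p.2,
      costf p.1 p.2 + average costf C = average costf A + average costf B,
      average (fun y _ => lossf y) A + average (fun y _ => lossf y) B <=
        lossf p.1 + average (fun y _ => lossf y) C &
      forall F : V -> R, F p.2 + F (centre C) = F (centre A) + F (centre B)].
Proof.
move=> vA vB; rewrite /settle; case: ifPn; first exact: transfer_spec.
rewrite -ltNge => /ltW g; have := transfer_spec vB vA g.
case: (transfer B A) => p C [vC Zp cC lC FC]; split=> //.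
- by rewrite cC addrC.
- by rewrite addrC.
- by move=> F; rewrite FC addrC.
Qed.

(** Induction on the remaining samples, with the carried item generalized. As [F] is arbitrary, the
    last clause determines the marginal of the plan on the samples. *)
Lemma collapse_spec (T : Type) (g : T -> item R m) (Z : set V) w A r :
  0 <= w -> valid Z A -> (forall i, valid Z (g i)) ->
  let s := collapse w A [seq g i | i <- r] in
  [/\ nonneg_weights s, {in s, forall q, Z q.2.1 /\ Z q.2.2},
      \sum_(q <- s) q.1 * costf q.2.1 q.2.2 =
        w * (average costf A + \sum_(i <- r) average costf (g i)),
      w * (average (fun y _ => lossf y) A +
           \sum_(i <- r) average (fun y _ => lossf y) (g i)) <=
        \sum_(q <- s) q.1 * lossf q.2.1 &
      forall F : V -> R, \sum_(q <- s) q.1 * F q.2.2 =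
        w * (F (centre A) + \sum_(i <- r) F (centre (g i)))].
Proof.
move=> w0 + vg; elim: r A => [|i r IH] A vA /=.
  have [/andP[a0 a1] _ Zl Zh Zc] := vA.
  split.
  - by rewrite /nonneg_weights /= !mulr_ge0 ?subr_ge0.
  - by move=> q; rewrite !inE => /orP[]/eqP->.
  - by rewrite big_cons big_seq1 big_nil /average /=; ring.
  - by rewrite big_cons big_seq1 big_nil /average /= addr0 mulrDr !mulrA.
  - by move=> F; rewrite big_cons big_seq1 big_nil /=; ring.
have := settle_spec vA (vg i).
case: (settle A (g i)) => p C [vC Zp cC lC FC] /=.
have [sw sZ sc sl sF] := IH _ vC; split.
- by rewrite /nonneg_weights /= w0.
- by move=> q; rewrite inE => /orP[/eqP->//|]; exact: sZ.
- by rewrite !big_cons sc /= -mulrDr addrA cC -addrA.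
- rewrite !big_cons /=; apply: le_trans (lerD (lexx _) sl).
  by rewrite -mulrDr ler_wpM2l// [leRHS]addrA [leLHS]addrA lerD2r.
- by move=> F; rewrite !big_cons sF /= -mulrDr addrA FC -addrA.
Qed.

Lemma size_collapse w A s : size (collapse w A s) = (size s).+2.
Proof. by elim: s A => //= B s IH A; rewrite IH. Qed.

End Exchange.

(** * Finitely supported measures *)

(** A singleton is closed, as an intersection of preimages of points under the continuous
    coordinates. *)
Lemma measurable_set1_borel (R : realType) (m : nat) (y : 'rV[R]_m) :
  measurable ([set y] : set (borel R m)).
Proof.
have cy : closed ([set y] : set 'rV[R]_m).
  have -> : [set y] = \bigcap_(j in [set: 'I_m])
      ((fun x : 'rV[R]_m => x 0 j) @^-1` [set y 0 j]).
    apply/seteqP; split => [_ -> //|x xy].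
    by apply/rowP => j; exact: (xy j).
  apply: closed_bigI => j _; apply: preimage_closed => [x _|].
    exact: coord_continuous.
  exact/accessible_closed_set1/hausdorff_accessible/Rhausdorff.
rewrite -[X in measurable X]setCK; apply: measurableC.
by apply: sub_sigma_algebra; apply: closed_openC.
Qed.

Section DiscreteMeasure.
Import HBNNSimple.
Context (d : measure_display) (T : measurableType d) (R : realType).
Hypothesis measurable_set1T : forall y : T, measurable [set y].
Implicit Types (s : seq (R * T)) (f : T -> R).

(* Absolute values make the weights nonnegative by construction; they are
   harmless because only nonnegative weights occur. *)
Definition discrete_measure s : set T -> \bar R :=
  let m k : {measure set T -> \bar R} :=
    let a := nth (0, point) s k in mscale (`|a.1|%:nng) (dirac a.2) in
  msum m (size s).

HB.instance Definition _ s := Measure.on (discrete_measure s).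

Lemma discrete_measureE s (A : set T) : nonneg_weights s ->
  discrete_measure s A = (\sum_(a <- s) a.1 * \1_A a.2)%:E.
Proof.
move=> /allP s0; rewrite /discrete_measure /msum /mscale /dirac /=.
rewrite (big_nth (0, point)) big_mkord -sumEFin; apply: eq_bigr => k _.
by rewrite EFinM /mscale /= ger0_norm// s0// mem_nth.
Qed.

Let integral_measurable s (f : T -> \bar R) : nonneg_weights s ->
  (forall x, (0 <= f x)%E) -> measurable_fun setT f ->
  (\int[discrete_measure s]_x f x = \sum_(a <- s) a.1%:E * f a.2)%E.
Proof.
move=> /allP s0 f0 mf; rewrite ge0_integral_measure_sum//.
rewrite (big_nth (0, point)) big_mkord; apply: eq_bigr => k _.
rewrite ge0_integral_mscale// integral_dirac//= diracT mul1e.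
by rewrite ger0_norm// s0// mem_nth.
Qed.

(** The preimage of [B], or its complement if [B] contains 0, lies in the finite support and is a
    finite union of singletons. *)
Let measurable_fun_finite_support (s : seq T) (f : T -> \bar R) :
  measurable_fun setT (f \_ [set` s]).
Proof.
have ms (A : set T) : A `<=` [set` s] -> measurable A.
  move=> As; have -> : A = \bigcup_(y in A) [set y].
    by apply/seteqP; split => [y Ay|y [_ Az ->]//]; exists y.
  apply: fin_bigcup_measurable => //.
  by apply: sub_finite_set As _; exact: finite_seq.
move=> _ B mB; rewrite setTI.
have [B0|B0] := pselect (B 0%E).
  rewrite -[X in measurable X]setCK; apply/measurableC/ms => x /= Bx.
  by apply: contrapT => sx; apply: Bx; rewrite patchE memNset.
apply: ms => x /= Bx; apply: contrapT => sx; apply: B0.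
by move: Bx; rewrite patchE memNset.
Qed.

(* The integral is a supremum over measurable simple functions below the
   integrand; as finite sets are measurable, the integrand itself may be
   non-measurable. *)
Let ge0_integral_discrete s (f : T -> \bar R) : nonneg_weights s ->
  (forall x, (0 <= f x)%E) ->
  (\int[discrete_measure s]_x f x = \sum_(a <- s) a.1%:E * f a.2)%E.
Proof.
move=> s0 f0; apply/eqP; rewrite eq_le; apply/andP; split.
  rewrite ge0_integralTE//; apply: ge_ereal_sup => _ [h /= hf <-].
  rewrite -integralT_nnsfun integral_measurable//; last first.
  - exact/measurable_EFinP/measurable_funPT.
  - by move=> x; rewrite lee_fin.
  rewrite big_seq [leRHS]big_seq; apply: lee_sum => a sa.
  by rewrite lee_wpmul2l// lee_fin; move/allP: s0 => /(_ _ sa).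
(* Cutting [f] down to the atoms makes it measurable, leaves the sum unchanged and can only lower
   the integral. *)
pose E := [set` [seq a.2 | a <- s]].
have g0 x : (0 <= (f \_ E) x)%E by rewrite patchE; case: ifP.
have -> : (\sum_(a <- s) a.1%:E * f a.2 =
           \sum_(a <- s) a.1%:E * (f \_ E) a.2)%E.
  rewrite big_seq [RHS]big_seq; apply: eq_bigr => a sa.
  by rewrite patchE mem_set//=; apply/mapP; exists a.
rewrite -integral_measurable//; last exact: measurable_fun_finite_support.
rewrite !ge0_integralTE//; apply: le_ereal_sup => _ [h /= hf <-].
exists h => // x; apply: le_trans (hf x) _.
by rewrite patchE; case: ifP.
Qed.

Lemma integral_discrete s (D : set T) f : nonneg_weights s ->
  {in s, forall a, D a.2} ->
  (\int[discrete_measure s]_(x in D) (f x)%:E)%E =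
  (\sum_(a <- s) a.1 * f a.2)%:E.
Proof.
move=> s0 sD; rewrite integral_mkcond integralE !ge0_integral_discrete//.
have fD a : a \in s -> ((EFin \o f) \_ D) a.2 = (f a.2)%:E.
  by move=> sa; rewrite patchE mem_set//; exact: sD.
under eq_big_seq => a sa do
  rewrite funeposE fD// -EFin_max -EFinM.
under [X in (_ - X)%E]eq_big_seq => a sa do
  rewrite funenegE fD// -EFinN -EFin_max -EFinM.
rewrite !sumEFin -EFinB -sumrB; congr EFin; apply: eq_bigr => a _.
rewrite -mulrBr; congr (_ * _).
have [fa|fa] := leP 0 (f a.2).
  by rewrite max_r ?oppr_le0// subr0.
by rewrite max_l ?oppr_ge0 ?(ltW fa)// sub0r opprK.
Qed.

Lemma discrete_probability s : nonneg_weights s -> \sum_(a <- s) a.1 = 1 ->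
  exists2 Q : probability T R,
    Q = discrete_measure s :> (set T -> \bar R) &
    forall A, Q A = (\sum_(a <- s) a.1 * \1_A a.2)%:E.
Proof.
move=> s0 s1; have mT : discrete_measure s setT = 1%E.
  rewrite discrete_measureE//; congr EFin; rewrite -[RHS]s1.
  by apply: eq_bigr => a _; rewrite indicT mulr1.
pose P := Measure_isProbability.Build _ _ _ (discrete_measure s) mT.
pose Q : probability T R := HB.pack (discrete_measure s) P.
by exists Q => // A; exact: discrete_measureE.
Qed.

End DiscreteMeasure.

(** * The program and its running time *)

(** The unit branch is a dummy. These abbreviations copy [e], which is then evaluated again at each
    use; this costs a constant factor only. *)
Definition efst e := ECase e EUnit (EVar 0).
Definition esnd e := ECase e EUnit (EVar 1).
Definition eitem z a y y' := EPair z (EPair a (EPair y y')).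
Definition ecentre e := efst e.
Definition etilt e := efst (esnd e).
Definition elow e := efst (esnd (esnd e)).
Definition ehigh e := esnd (esnd (esnd e)).
Definition eretilt e a := eitem (ecentre e) a (elow e) (ehigh e).
Definition edcost e := EArith OSub (ECost (ehigh e) (ecentre e))
                                   (ECost (elow e) (ecentre e)).
Definition edloss e := EArith OSub (ELoss (ehigh e)) (ELoss (elow e)).
Definition eneg_tilt e := EArith OSub EOne (etilt e).
Definition eflip e := eitem (ecentre e) (eneg_tilt e) (ehigh e) (elow e).

(** Functions are called by their position in [collapse_prog]. Variable 2 is the whole input below
    the case, so the length is taken over all records. *)
Definition main_body : expr :=
  ECase (esnd (EVar 0)) EUnit
    (ECall 5 (EPair (EArith ODiv EOne (ECall 1 (esnd (EVar 2))))
                    (EPair (ECall 2 (EVar 0)) (EVar 1)))).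

Definition length_body : expr :=
  ECase (EVar 0) EZero (EArith OAdd EOne (ECall 1 (EVar 1))).

(* The fields of a record are sample, budget, value, optimizer, indices; those
   of an optimizer are two weights, two shares, two perturbations. *)
Definition item_body : expr :=
  let s := efst (esnd (esnd (esnd (EVar 0)))) in
  let p := esnd (esnd (esnd (esnd s))) in
  ELet (eitem (efst (EVar 0)) (efst (esnd s))
              (EVecAdd (efst (EVar 0)) (efst p))
              (EVecAdd (efst (EVar 0)) (efst (esnd p))))
    (EIfLe EZero (edcost (EVar 0))
      (EIfLe (edcost (EVar 0)) EZero
        (EIfLe EZero (edloss (EVar 0)) (EVar 0) (eflip (EVar 0)))
        (EVar 0))
      (eflip (EVar 0))).

(** Only the split-off point is returned; its sample is tracked in the proof alone. *)
Definition transfer_body : expr :=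
  let A := efst (EVar 0) in
  let B := esnd (EVar 0) in
  let up := EArith OMul (eneg_tilt A) (edcost A) in
  let down := EArith OMul (etilt B) (edcost B) in
  EIfLe up down
    (EPair (ehigh A)
           (eretilt B (EArith OSub (etilt B) (EArith ODiv up (edcost B)))))
    (EPair (elow B)
           (eretilt A (EArith OAdd (etilt A) (EArith ODiv down (edcost A))))).

Definition settle_body : expr :=
  let A := efst (EVar 0) in
  let B := esnd (EVar 0) in
  EIfLe (EArith OMul (edloss B) (edcost A)) (EArith OMul (edloss A) (edcost B))
    (ECall 3 (EVar 0)) (ECall 3 (EPair B A)).

Definition collapse_body : expr :=
  ECase (esnd (esnd (EVar 0)))
    (let w := efst (EVar 0) in
     let A := efst (esnd (EVar 0)) in
     EPair (EPair (EArith OMul w (eneg_tilt A)) (elow A))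
       (EPair (EPair (EArith OMul w (etilt A)) (ehigh A)) EUnit))
    (let A := efst (esnd (EVar 2)) in
     ELet (ECall 4 (EPair A (ECall 2 (EVar 0))))
       (let w := efst (EVar 3) in
        EPair (EPair w (efst (EVar 0)))
          (ECall 5 (EPair w (EPair (esnd (EVar 0)) (EVar 2)))))).

Definition collapse_prog : program :=
  [:: main_body; length_body; item_body; transfer_body; settle_body;
      collapse_body].

(** * Step counts *)

Section Execution.
Variables (R : realType) (n m K N : nat) (I : instance R n m K N).
Variables (bbar : 'I_N -> R) (out : 'I_N -> local_output R m K).
Variables (lossf : 'rV[R]_m -> R) (costf : 'rV[R]_m -> 'rV[R]_m -> R).
Local Notation val := (value R m).
Local Notation eval := (Defs.eval lossf costf collapse_prog).
Implicit Types (env : seq val) (e : expr) (v : val).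
Implicit Types (A B : item R m) (k l : nat).

(** Upper bounds can be rounded up and can cover both branches of a conditional at once. *)
Definition eval_within env e v k := exists2 t, eval env e v t & (t <= k)%N.

Definition enc_item A : val :=
  VPair (VVec (centre A))
    (VPair (VReal (tilt A)) (VPair (VVec (low A)) (VVec (high A)))).

Lemma eval_withinW env e v k l :
  eval_within env e v k -> (k <= l)%N -> eval_within env e v l.
Proof. by move=> [t ? tk] kl; exists t => //; exact: leq_trans tk kl. Qed.

Lemma within_var env i v : (i < size env)%N -> nth VUnit env i = v ->
  eval_within env (EVar i) v 1.
Proof. by move=> lti <-; exists 1 => //; exact: eval_var. Qed.

Lemma within_unit env : eval_within env EUnit VUnit 1.
Proof. by exists 1 => //; exact: eval_unit. Qed.

Lemma within_pair env e1 e2 v1 v2 k l :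
  eval_within env e1 v1 k -> eval_within env e2 v2 l ->
  eval_within env (EPair e1 e2) (VPair v1 v2) (k + l).+1.
Proof.
by move=> [t ? ?] [u ? ?]; exists (t + u).+1;
  [eapply eval_pair; eassumption|lia].
Qed.

Lemma within_case_unit env e e1 e2 v k l :
  eval_within env e VUnit k -> eval_within env e1 v l ->
  eval_within env (ECase e e1 e2) v (k + l).+1.
Proof.
by move=> [t ? ?] [u ? ?]; exists (t + u).+1;
  [eapply eval_case_unit; eassumption|lia].
Qed.

Lemma within_case_pair env e e1 e2 v1 v2 v k l :
  eval_within env e (VPair v1 v2) k ->
  eval_within [:: v1, v2 & env] e2 v l ->
  eval_within env (ECase e e1 e2) v (k + l).+1.
Proof.
by move=> [t ? ?] [u ? ?]; exists (t + u).+1;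
  [eapply eval_case_pair; eassumption|lia].
Qed.

Lemma within_let env e1 e2 v1 v2 k l :
  eval_within env e1 v1 k -> eval_within (v1 :: env) e2 v2 l ->
  eval_within env (ELet e1 e2) v2 (k + l).+1.
Proof.
by move=> [t ? ?] [u ? ?]; exists (t + u).+1;
  [eapply eval_let; eassumption|lia].
Qed.

Lemma within_call env f e v w k l :
  eval_within env e v k -> (f < 6)%N ->
  eval_within [:: v] (nth EUnit collapse_prog f) w l ->
  eval_within env (ECall f e) w (k + l).+1.
Proof.
by move=> [t ? ?] ? [u ? ?]; exists (t + u).+1;
  [eapply eval_call; eassumption|lia].
Qed.

Lemma within_zero env : eval_within env EZero (VReal 0) 1.
Proof. by exists 1 => //; exact: eval_zero. Qed.

Lemma within_one env : eval_within env EOne (VReal 1) 1.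
Proof. by exists 1 => //; exact: eval_one. Qed.

Lemma within_arith env op e1 e2 r1 r2 k l :
  eval_within env e1 (VReal r1) k -> eval_within env e2 (VReal r2) l ->
  eval_within env (EArith op e1 e2) (VReal (arith op r1 r2)) (k + l).+1.
Proof.
by move=> [t ? ?] [u ? ?]; exists (t + u).+1;
  [eapply eval_arith; eassumption|lia].
Qed.

(** Charging for both branches avoids a case distinction on the comparison inside the step
    counts. *)
Lemma within_if_le env e1 e2 e3 e4 r1 r2 v3 v4 k1 k2 k3 k4 :
  eval_within env e1 (VReal r1) k1 -> eval_within env e2 (VReal r2) k2 ->
  eval_within env e3 v3 k3 -> eval_within env e4 v4 k4 ->
  eval_within env (EIfLe e1 e2 e3 e4) (if r1 <= r2 then v3 else v4)
    (k1 + k2 + (k3 + k4)).+1.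
Proof.
move=> [t1 ? ?] [t2 ? ?] [t3 e3t ?] [t4 e4t ?].
exists (t1 + t2 + (if r1 <= r2 then t3 else t4)).+1; last by case: ifP; lia.
by apply: eval_if_le; eauto; case: ifP.
Qed.

Lemma within_vec_add env e1 e2 z1 z2 k l :
  eval_within env e1 (VVec z1) k -> eval_within env e2 (VVec z2) l ->
  eval_within env (EVecAdd e1 e2) (VVec (z1 + z2)) (k + l).+1.
Proof.
by move=> [t ? ?] [u ? ?]; exists (t + u).+1;
  [eapply eval_vec_add; eassumption|lia].
Qed.

Lemma within_loss env e z k :
  eval_within env e (VVec z) k ->
  eval_within env (ELoss e) (VReal (lossf z)) k.+1.
Proof. by move=> [t ? ?]; exists t.+1; [exact: eval_loss|]. Qed.

Lemma within_cost env e1 e2 z1 z2 k l :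
  eval_within env e1 (VVec z1) k -> eval_within env e2 (VVec z2) l ->
  eval_within env (ECost e1 e2) (VReal (costf z1 z2)) (k + l).+1.
Proof.
by move=> [t ? ?] [u ? ?]; exists (t + u).+1;
  [eapply eval_cost; eassumption|lia].
Qed.

Lemma within_fst env e v1 v2 k :
  eval_within env e (VPair v1 v2) k -> eval_within env (efst e) v1 (k + 1).+1.
Proof. by move/within_case_pair; apply; exact: within_var. Qed.

Lemma within_snd env e v1 v2 k :
  eval_within env e (VPair v1 v2) k -> eval_within env (esnd e) v2 (k + 1).+1.
Proof. by move/within_case_pair; apply; exact: within_var. Qed.

Ltac run := repeat first
  [ apply: within_fst | apply: within_snd
  | apply: within_pair | apply: within_arith | apply: within_cost
  | apply: within_loss | apply: within_vec_add
  | apply: within_zero | apply: within_one | apply: within_unit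
  | (apply: within_var; [done|reflexivity]) ].

Lemma within_transfer A B :
  eval_within [:: VPair (enc_item A) (enc_item B)] transfer_body
    (VPair (VVec (transfer costf A B).1.1) (enc_item (transfer costf A B).2))
    400.
Proof.
rewrite [X in eval_within _ _ X _](_ : _ = if
  (1 - tilt A) * dcost costf A <= tilt B * dcost costf B
  then VPair (VVec (high A)) (enc_item
     (retilt B (tilt B - (1 - tilt A) * dcost costf A / dcost costf B)))
  else VPair (VVec (low B)) (enc_item
     (retilt A (tilt A + tilt B * dcost costf B / dcost costf A)))).
  by apply: eval_withinW; [apply: within_if_le; run|].
by rewrite /transfer; case: ifP.
Qed.

Lemma within_settle A B :
  eval_within [:: VPair (enc_item A) (enc_item B)] settle_body
    (VPair (VVec (settle lossf costf A B).1.1)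
           (enc_item (settle lossf costf A B).2)) 1000.
Proof.
rewrite [X in eval_within _ _ X _](_ : _ = if
  dloss lossf B * dcost costf A <= dloss lossf A * dcost costf B
  then VPair (VVec (transfer costf A B).1.1)
             (enc_item (transfer costf A B).2)
  else VPair (VVec (transfer costf B A).1.1)
             (enc_item (transfer costf B A).2)).
  apply: eval_withinW; [apply: within_if_le; run|].
  - by apply: within_call; [run| |exact: within_transfer].
  - by apply: within_call; [run| |exact: within_transfer].
  - by [].
by rewrite /settle; case: ifP.
Qed.

Definition enc_record (i : 'I_N) : val :=
  enc_seq [:: VVec (sample I i); VReal (bbar i); VReal (lo_value (out i));
              enc_optimizer (lo_opt (out i));
              VIdx (lo_k1 (out i)); VIdx (lo_k2 (out i))].

Definition sample_item (i : 'I_N) : item R m :=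
  let s := lo_opt (out i) in
  Item (sample I i) (weight2 s) (sample I i + pert1 s) (sample I i + pert2 s).

Lemma within_item i :
  eval_within [:: enc_record i] item_body
    (enc_item (orient lossf costf (sample_item i))) 500.
Proof.
set A := sample_item i.
rewrite [X in eval_within _ _ X _](_ : _ =
  if 0 <= dcost costf A then
    if dcost costf A <= 0 then
      if 0 <= dloss lossf A then enc_item A else enc_item (flip A)
    else enc_item A
  else enc_item (flip A)).
  apply: eval_withinW.
    apply: (@within_let _ _ _ (enc_item A)); first by run.
    by repeat first [progress run | apply: within_if_le].
  by [].
by rewrite /orient /ordered; do ![case: ifP => //=].
Qed.

Lemma within_length r :
  eval_within [:: enc_seq [seq enc_record i | i <- r]] length_body
    (VReal (size r)%:R) (6 * size r + 3).
Proof.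
elim: r => [|i r IH] /=.
  by apply: eval_withinW; [apply: within_case_unit; run|].
rewrite -natr1 addrC; apply: eval_withinW.
  apply: within_case_pair; first by run.
  apply: within_arith; first by run.
  by apply: within_call; [run| |exact: IH].
lia.
Qed.

(** Per sample, 1000 steps pay for [settle], 500 for decoding and orienting the record, and 100 for
    the glue. *)
Lemma within_collapse w A r :
  eval_within
    [:: VPair (VReal w)
          (VPair (enc_item A) (enc_seq [seq enc_record i | i <- r]))]
    collapse_body
    (enc_atoms [seq (q.1, q.2.1) | q <- collapse lossf costf w A
                 [seq orient lossf costf (sample_item i) | i <- r]])
    (1600 * size r + 100).
Proof.
elim: r A => [|i r IH] A /=.
  by apply: eval_withinW; [apply: within_case_unit; run|].
set B := orient _ _ _; apply: eval_withinW.
  apply: within_case_pair; first by run.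
  apply: within_let.
    apply: within_call; [|by []|exact: (within_settle A B)].
    by apply: within_pair; [run|apply: within_call; [run| |exact: within_item]].
  apply: within_pair; first by run.
  by apply: within_call; [run| |exact: IH].
lia.
Qed.

Lemma runs_collapse i r : enum 'I_N = i :: r ->
  exists2 t, runs lossf costf collapse_prog (enc_master I bbar out)
    (enc_atoms [seq (q.1, q.2.1) | q <- collapse lossf costf (N%:R^-1)
       (orient lossf costf (sample_item i))
       [seq orient lossf costf (sample_item j) | j <- r]]) t &
    (t <= 2500 * N)%N.
Proof.
move=> eN; have sN : N = (size r).+1 by rewrite -[LHS]card_ord cardE eN.
rewrite -/(eval_within _ _ _ _) /enc_master eN [X in VPair _ X]/=.
apply: eval_withinW.
  apply: within_call; [by run|by []|].
  apply: within_case_pair; first by run.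
  apply: within_call; [|by []|exact: (within_collapse _ _ r)].
  apply: within_pair.
    rewrite -div1r [N in N%:R]sN; apply: within_arith; first by run.
    by apply: within_call; [run|by []|exact: (within_length (i :: r))].
  by apply: within_pair; [apply: within_call; [run| |exact: within_item]|run].
by move: sN => /=; move: (size r) => k ->; lia.
Qed.

End Execution.

(** * Output of MasterEval *)

Lemma phi_itv (R : realType) : 0 < phi R < 1.
Proof.
have s2 : 1 < Num.sqrt 5 :> R by rewrite -[ltLHS]sqrtr1 ltr_sqrt// ltr1n.
have s3 : Num.sqrt 5 < 3 :> R.
  by rewrite -(@ltr_pXn2r _ 2)// ?nnegrE// sqr_sqrtr//; lra.
by rewrite /phi; apply/andP; split; lra.
Qed.

Section GoldenSection.
Variables (R : realType) (S : Type) (eta : R) (ev : R -> R * S -> Prop).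

(* E contains the ends of the search intervals, D the evaluated points. *)
Lemma gs_loop_evaluated (E D : set R) L U t1 t2 o1 o2 f1 f2 :
  D `<=` E -> (forall t e, D t -> E e -> D (t + phi R * (e - t))) ->
  gs_loop eta ev L U t1 t2 o1 o2 f1 f2 ->
  E L -> E U -> D t1 -> D t2 ->
  (exists2 t, D t & ev t o1) -> (exists2 t, D t & ev t o2) ->
  (exists2 t, D t & ev t f1) /\ (exists2 t, D t & ev t f2).
Proof.
move=> DE DD; elim=> {L U t1 t2 o1 o2 f1 f2} //.
- move=> L U t1 t2 o1 o2 o1' o2' f1 f2 _ e1 e2 _ _ IH EL EU D1 D2 _ _.
  by apply: IH; [exact: DE|by []|by []|exact: DD|exists t1|exists t2].
- move=> L U t1 t2 o1 o2 o1' o2' f1 f2 _ e1 e2 _ _ IH EL EU D1 D2 _ _.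
  apply: IH; [by []|exact: DE| |by []|by exists t1|by exists t2].
  by rewrite -mulrN opprB; exact: DD.
Qed.

Lemma golden_section_evaluated (a b : R) o :
  golden_section eta ev a b o -> exists t, ev t o.
Proof.
move=> [ o1 [ o2 [f1 [f2 [e1 e2 l fo]]]]].
have [] := @gs_loop_evaluated setT setT _ _ _ _ _ _ _ _ _ _ l I I I I.
- by [].
- by [].
- by exists (b - phi R * (b - a)).
- by exists (a + phi R * (b - a)).
move=> [t _ ft] [u _ fu].
by case: fo => -[-> _]; [exists t|exists u].
Qed.

(** Each new point is a strict convex combination of an interior point and an end of the search
    interval, since [phi] lies strictly between 0 and 1. *)
Lemma golden_section_interior (a b : R) o : a < b ->
  golden_section eta ev a b o -> exists2 t, a < t < b & ev t o.
Proof.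
move=> ab [ o1 [ o2 [f1 [f2 [e1 e2 l fo]]]]].
have /andP[p0 p1] := phi_itv R.
have b1 : a < b - phi R * (b - a) < b by apply/andP; split; nra.
have b2 : a < a + phi R * (b - a) < b by apply/andP; split; nra.
have [] := @gs_loop_evaluated [set t | a <= t <= b] [set t | a < t < b]
  _ _ _ _ _ _ _ _ _ _ l _ _ b1 b2.
- by move=> t /= /andP[? ?]; rewrite !ltW.
- by move=> t e /= /andP[? ?] /andP[? ?]; apply/andP; split; nra.
- by rewrite /= lexx ltW.
- by rewrite /= lexx ltW.
- by exists (b - phi R * (b - a)).
- by exists (a + phi R * (b - a)).
move=> [t Dt ft] [u Du fu].
by case: fo => -[-> _]; [exists t|exists u].
Qed.

End GoldenSection.

Section Outputs.
Variables (R : realType) (n m K N : nat) (I : instance R n m K N).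
Variables (x : 'rV[R]_n) (wco : R -> 'I_K -> 'rV[R]_m -> R -> R * 'rV[R]_m).
Variables (eps eta : R).
Hypotheses (Zsample : forall i, uncertainty I (sample I i)).
Hypotheses (wco_spec : oracle_spec I x wco) (eps_gt0 : 0 < eps).
Local Notation Z := (uncertainty I).
Local Notation c := (cost I).
Local Notation zhat := (sample I).

(** The weights [a] and [1 - a] are positive, so the oracle bounds [be / a] and
    [(b - be) / (1 - a)], multiplied by them, add up to [b]. *)
Lemma local_eval_spec i b o : local_eval I wco eps eta i b o ->
  let s := lo_opt o in
  [/\ 0 <= weight2 s <= 1, weight1 s = 1 - weight2 s,
      Z (zhat i + pert1 s), Z (zhat i + pert2 s) &
      weight1 s * c (zhat i + pert1 s) (zhat i) +
      weight2 s * c (zhat i + pert2 s) (zhat i) <= b].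
Proof.
move=> [_ + _]; move=> /(golden_section_interior ltr01)[a /andP[a0 a1]].
have a2 : 0 < 1 - a by rewrite subr_gt0.
move=> /golden_section_evaluated[be]; rewrite /inner_eval.
have w1 := @wco_spec eps (lo_k1 o) (zhat i) (be / a) eps_gt0 (Zsample i).
have w2 := @wco_spec eps (lo_k2 o) (zhat i) ((b - be) / (1 - a)) eps_gt0
  (Zsample i).
case: (wco _ _ _ (be / a)) w1 => L1 v1 w1.
case: (wco _ _ _ ((b - be) / _)) w2 => L2 v2 w2 [u1 u2 [_ ->]] /=.
have [Z1 c1 _ _] := w1 u1; have [Z2 c2 _ _] := w2 u2.
split=> //; first by rewrite ltW//= gerBl ltW.
  by rewrite opprB addrC subrK.
move: c1 c2; rewrite !ler_pdivlMr// => c1 c2.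
by lra.
Qed.

(** If [s1 != s2], then [theta] makes the total exactly the target, whatever its sign or size. If
    [s1 = s2], the convention for division by 0 gives [theta = 0], and the total is [s2], which is
    affordable. *)
Lemma master_eval_budget Ulam bbar out :
  master_eval I wco eps eta Ulam bbar out ->
  \sum_i bbar i <= N%:R * Defs.radius I.
Proof.
move=> [_ [_ [b1 [b2 [_ _ ne bE _]]]]].
under eq_bigr do rewrite bE.
rewrite big_split/= -!mulr_sumr.
move: ne; set s1 := \sum_i b1 i; set s2 := \sum_i b2 i; set T := _ * _.
have [->|ne _] := eqVneq s1 s2.
  by move=> [|sT]; rewrite ?eqxx// subrr invr0 mulr0 mul0r add0r subr0 mul1r.
rewrite le_eqVlt; apply/orP; left; apply/eqP; field.
by rewrite subr_eq0.
Qed.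

Lemma master_eval_local Ulam bbar out :
  master_eval I wco eps eta Ulam bbar out ->
  forall i, local_eval I wco eps eta i (bbar i) (out i).
Proof. by move=> [? [? [? [? []]]]]. Qed.

End Outputs.

(** * Transport plans with finitely many atoms and the ambiguity set *)

Lemma discreteE (R : realType) (m : nat) (s : seq (R * 'rV[R]_m))
    (A : set (borel R m)) :
  discrete s A = (\sum_(a <- s) a.1 * \1_A a.2)%:E.
Proof. by rewrite /discrete -sumEFin; apply: eq_bigr => a _; rewrite EFinM. Qed.

Lemma discrete_measure_discrete (R : realType) (m : nat)
    (s : seq (R * 'rV[R]_m)) : nonneg_weights s ->
  discrete s = discrete_measure (s : seq (R * borel R m)).
Proof.
by move=> s0; apply/funext => A; rewrite discreteE discrete_measureE.
Qed.

Lemma expected_value_discrete (R : realType) (m : nat)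
    (s : seq (R * 'rV[R]_m)) (f : 'rV[R]_m -> R) : nonneg_weights s ->
  expected_value (discrete s) f = (\sum_(a <- s) a.1 * f a.2)%:E.
Proof.
move=> s0; rewrite discrete_measure_discrete// /expected_value.
by rewrite (@integral_discrete _ (borel R m))//; exact: measurable_set1_borel.
Qed.

Section CoupledAtoms.
Variables (R : realType) (n m K N : nat) (I : instance R n m K N).
Variable (J : seq (R * ('rV[R]_m * 'rV[R]_m))).
Local Notation Z := (uncertainty I).
Hypotheses (N_gt0 : (0 < N)%N) (J0 : nonneg_weights J).
Hypothesis JZ : {in J, forall q, Z q.2.1 /\ Z q.2.2}.
Hypothesis Jmarginal : forall F : 'rV[R]_m -> R,
  \sum_(q <- J) q.1 * F q.2.2 = N%:R^-1 * \sum_(i < N) F (sample I i).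
Hypothesis Jcost : \sum_(q <- J) q.1 * cost I q.2.1 q.2.2 <= Defs.radius I.

Local Notation first_atoms := [seq (q.1, q.2.1) | q <- J].

Lemma coupled_atoms_mass : \sum_(q <- J) q.1 = 1.
Proof.
have := Jmarginal (fun=> 1); under eq_bigr do rewrite mulr1.
move=> ->; rewrite sumr_const card_ord mulVf// pnatr_eq0.
by rewrite -lt0n.
Qed.

Lemma nonneg_first_atoms : nonneg_weights first_atoms.
Proof. by rewrite /nonneg_weights all_map. Qed.

(** The plan [J] itself is a coupling of its first marginal with the empirical distribution, so its
    cost bounds the infimum [OT]. *)
Lemma coupled_atoms_ambiguity : exists2 Q : probability (borel R m) R,
  Q = discrete first_atoms :> (set (borel R m) -> \bar R) &
  ambiguity_set I Q.
Proof.
have s0 := nonneg_first_atoms.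
have s1 : \sum_(a <- first_atoms) a.1 = 1 by rewrite big_map coupled_atoms_mass.
have [Q QE Q1] := @discrete_probability _ (borel R m) _ _ s0 s1.
exists Q; first by rewrite QE discrete_measure_discrete.
split.
  rewrite Q1 big_map -[RHS]/(1%:E) -coupled_atoms_mass; congr EFin.
  rewrite big_seq [RHS]big_seq; apply: eq_bigr => q Jq /=.
  by rewrite indicE mem_set ?mulr1//; case: (JZ Jq).
have [g gE g1] := @discrete_probability _ (borel R m * borel R m)%type _ _ J0
  coupled_atoms_mass.
apply: le_trans (ereal_inf_lbound _) _; first exists g.
- move=> A mA; split; first by rewrite g1 Q1 big_map.
  (* The second marginal comes from [Jmarginal] at an indicator function. *)
  rewrite g1 /empirical discreteE big_map big_enum/=.
  by rewrite (Jmarginal (\1_A)) mulr_sumr.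
- reflexivity.
rewrite gE integral_discrete ?lee_fin//.
move=> [y z]; have -> : [set (y, z)] = [set y] `*` [set z].
  by apply/seteqP; split=> [_ ->//|[? ?] [/= -> ->]].
by apply: measurableX; exact: measurable_set1_borel.
Qed.

End CoupledAtoms.

(** * Feasibility, running time, support and loss of the collapsed distribution *)

Theorem theorem3 (R : realType) :
  exists (prog : program) (C : R),
  forall (n m K N : nat) (I : instance R n m K N)
    (x : 'rV[R]_n)
    (wco : R -> 'I_K -> 'rV[R]_m -> R -> R * 'rV[R]_m)
    (eps eta lamstar Ulam : R)
    (bbar : 'I_N -> R) (out : 'I_N -> local_output R m K),
    setting I -> regularity I -> decisions I x ->
    oracle_spec I x wco -> 0 < eps -> 0 < eta ->
    optimal_multiplier I x lamstar -> lamstar <= Ulam ->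
    master_eval I wco eps eta Ulam bbar out ->
    exists (atoms : seq (R * 'rV[R]_m)) (t : nat)
           (Q : probability (borel R m) R),
      [/\ runs (loss I x) (cost I) prog (enc_master I bbar out)
            (enc_atoms atoms) t,
          (2 <= N)%N -> t%:R <= C * (N%:R * ln N%:R),
          (size atoms <= N.+1)%N,
          forall A, measurable A -> Q A = discrete atoms A &
          ambiguity_set I Q /\
          (expected_value (discrete (atoms2N I out)) (loss I x)
             <= expected_value Q (loss I x))%E].
Proof.
(* The run takes at most [2500 * N] steps, and [ln 2 <= ln N] once [2 <= N]. *)
exists collapse_prog, (2500 / ln 2) => n m K N I x wco eps eta lamstar Ulam.
move=> bbar out [N0 _ Zs _] _ _ wcoP e0 _ _ _ mE.
have budget := master_eval_budget mE.
have loc i := local_eval_spec Zs wcoP e0 (master_eval_local mE i).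
pose g i := orient (loss I x) (cost I) (sample_item I out i).
have gV i : valid (loss I x) (cost I) (uncertainty I) (g i).
  by have [a01 _ Z1 Z2 _] := loc i; apply: valid_orient => //; exact: Zs.
(* Orientation only renames the two points, so this average is the contribution of sample [i] in
   [atoms2N], up to the factor [1 / N]. *)
have avg f i : average f (g i) =
    weight1 (lo_opt (out i)) *
      f (sample I i + pert1 (lo_opt (out i))) (sample I i) +
    weight2 (lo_opt (out i)) *
      f (sample I i + pert2 (lo_opt (out i))) (sample I i).
  by have [_ w1 _ _ _] := loc i; rewrite average_orient /average /= w1.
have N1 : 0 <= N%:R^-1 :> R by rewrite invr_ge0.
have : size (enum 'I_N) = N by rewrite -cardE card_ord.
case eN : (enum 'I_N) => [|i0 r]; first by move=> N00; rewrite -N00 in N0.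
move=> sN; pose J := collapse (loss I x) (cost I) N%:R^-1 (g i0)
  [seq g i | i <- r].
have [J0 JZ Jc Jl JF] := collapse_spec r N1 (gV i0) gV.
rewrite -/J in J0 JZ Jc Jl JF.
have sumE (F : 'I_N -> R) : F i0 + \sum_(i <- r) F i = \sum_i F i.
  by rewrite -big_enum eN big_cons.
rewrite (sumE (fun i => average _ (g i))) in Jc.
rewrite (sumE (fun i => average _ (g i))) in Jl.
have [t Ht tN] := runs_collapse I bbar out (loss I x) (cost I) eN.
have Jm (F : 'rV[R]_m -> R) :
    \sum_(q <- J) q.1 * F q.2.2 = N%:R^-1 * \sum_i F (sample I i).
  rewrite JF (sumE (fun i => F (centre (g i)))); congr (_ * _).
  by apply: eq_bigr => i _; rewrite /g centre_orient.
have Jr : \sum_(q <- J) q.1 * cost I q.2.1 q.2.2 <= Defs.radius I.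
  rewrite Jc mulrC ler_pdivrMr ?ltr0n// mulrC; apply: le_trans budget.
  by apply: ler_sum => i _; rewrite avg; case: (loc i).
have [Q QE QP] := coupled_atoms_ambiguity N0 J0 JZ Jm Jr.
exists [seq (q.1, q.2.1) | q <- J], t, Q; split.
- exact: Ht.
- move=> N2; have l2 : 0 < ln 2 :> R by rewrite ln_gt0// ltr1n.
  apply: (@le_trans _ _ (2500 * N%:R)); first by rewrite -natrM ler_nat.
  rewrite -!mulrA; apply: ler_wpM2l; first exact: ler0n.
  rewrite mulrCA; apply: ler_peMr; first exact: ler0n.
  by rewrite mulrC ler_pdivlMr// mul1r ler_ln ?posrE ?ltr0n// ler_nat.
(* The [N - 1] samples in [r] yield one atom each, and the last carried item yields two. *)
- by rewrite size_map size_collapse size_map -[in leqRHS]sN.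
- by move=> A _; rewrite QE.
- split=> //; have s0 : nonneg_weights (atoms2N I out).
    apply/allP => a /flattenP[_ /mapP[i _ ->]].
    have [/andP[a0 a1] w1 _ _ _] := loc i.
    by rewrite !inE => /orP[]/eqP->/=; rewrite mulr_ge0// w1 subr_ge0.
  rewrite QE (expected_value_discrete _ s0).
  rewrite (expected_value_discrete _ (nonneg_first_atoms J0)).
  rewrite lee_fin [leRHS]big_map; apply: le_trans Jl.
  rewrite /atoms2N big_flatten big_map big_enum /= mulr_sumr.
  apply: ler_sum => i _.
  by rewrite big_cons big_seq1 /= avg mulrDr !mulrA.
Qed.
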